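(* Let $X$ be a stochastic process with continuous sample paths over $[0,1]$, let $\|\cdot\|_\infty$ be the sup-norm on $\mathcal{C}[0,1]$ and $\|\cdot\|$ the $L^2[0,1]$-norm. Assume that, for some $\alpha>0$, $X\in RV_{-\alpha}(\mathcal{C}[0,1])$, with $\mathcal{L}(X/\|X\|_\infty\mid\|X\|_\infty>t)\to\mathcal{L}(\Theta_{\infty,\infty})$ weakly (in $\mathcal{C}[0,1]$) as $t\to+\infty$, where $\Theta_{\infty,\infty}$ is the angular limit process with respect to the sup-norm. Then $X\in RV_{-\alpha}(L^2[0,1])$, and the angular limit $\Theta_{\infty,2}$ with respect to the $L^2$-norm (that is, the weak limit in $L^2[0,1]$ of $\mathcal{L}(X/\|X\|\mid\|X\|>t)$ as $t\to\infty$) has distribution given by $$\mathbb{P}(\Theta_{\infty,2}\in B)=\frac{\mathbb{E}\big[\|\Theta_{\infty,\infty}\|^\alpha\,\mathbf{1}\{\Theta_{\infty,\infty}/\|\Theta_{\infty,\infty}\|\in B\}\big]}{\mathbb{E}\big[\|\Theta_{\infty,\infty}\|^\alpha\big]}$$ for every Borel subset $B$ of the unit sphere $\mathbb{S}_2=\{x\in L^2[0,1]:\|x\|=1\}$.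
   Context: A continuous process on $[0,1]$ is regarded as a random element of $\mathcal{C}[0,1]$ (with the sup-norm) and also of $L^2[0,1]$. Regular variation. Let $E$ be a separable real Banach space (here $E=\mathcal{C}[0,1]$ with the sup-norm, or $E=L^2[0,1]$) and $E_0=E\setminus\{0\}$. Let $\mathcal{C}_0$ be the set of bounded continuous functions $f:E_0\to\mathbb{R}$ vanishing in some neighborhood of $0$, and $M_0(E)$ the class of Borel measures on $E_0$ that are finite on every Borel subset of $E_0$ bounded away from $0$. A sequence $\mu_n$ converges to $\mu$ in $M_0(E)$ if $\int f\,d\mu_n\to\int f\,d\mu$ for all $f\in\mathcal{C}_0$. A measurable function $b$ is regularly varying with index $\rho$ if $b(tx)/b(t)\to x^\rho$ as $t\to\infty$ for every $x>0$. A random element $X$ of $E$ is regularly varying with index $\alpha>0$ (written $X\in RV_{-\alpha}(E)$) if there exist a nonzero $\mu\in M_0(E)$ and a regularly varying function $b$ such that $b(n)\,\mathbb{P}(X\in n\,\cdot)\to\mu(\cdot)$ in $M_0(E)$ as $n\to\infty$, where the limit satisfies $\mu(tA)=t^{-\alpha}\mu(A)$ for all $t>0$ and Borel $A\subset E_0$. *)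

(* Defs.v *)
From HB Require Import structures.
From mathcomp Require Import all_boot all_order all_algebra generic_quotient.
From mathcomp Require Import all_classical all_reals all_analysis.
From mathcomp Require Import measurable_realfun ess_sup_inf.

Set Implicit Arguments.
Unset Strict Implicit.
Unset Printing Implicit Defensive.

Import Order.TTheory GRing.Theory Num.Theory numFieldNormedType.Exports.

Local Open Scope classical_set_scope.
Local Open Scope ring_scope.

(* `LspaceType` has no algebraic structure in the library: make it a normed
   module, with operations computed on representatives. *)
Section Lspace_normedModType.
Context d (T : measurableType d) (R : realType).
Variables (mu : {measure set T -> \bar R}) (p : \bar R) (p1 : (1 <= p)%E).

Local Notation Lp := (LspaceType mu p1).

HB.instance Definition _ := gen_eqMixin Lp.
HB.instance Definition _ := gen_choiceMixin Lp.

Lemma ae_eq_Lnorm (f g : {mfun T >-> R}) : f = g %[ae mu] ->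
  ('N[mu]_p[EFin \o f] = 'N[mu]_p[EFin \o g])%E.
Proof.
move=> fg; rewrite unlock /Lnorm; case: p p1 => [r r1| _|//].
- congr (_ `^ _)%E; apply: ge0_ae_eq_integral => //=.
  + apply/measurable_EFinP; apply: (measurableT_comp (measurable_powR _)).
    exact: measurableT_comp.
  + apply/measurable_EFinP; apply: (measurableT_comp (measurable_powR _)).
    exact: measurableT_comp.
  + by apply: (filterS _ fg) => x /= /(_ Logic.I) -> _.
- case: ifPn => // mu0; apply: eq_ess_sup.
  by apply: (filterS _ fg) => x /= /(_ Logic.I) ->.
Qed.

Local Notation mR := (measurableTypeR R).

(* `R` and `measurableTypeR R` carry the same sigma-algebra but different
   displays, and `LspaceType` is stated with the latter. *)
Definition to_measurableTypeR (f : T -> R) : T -> mR := f.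

HB.instance Definition _ (f : {mfun T >-> R}) :=
  @isMeasurableFun.Build _ _ T mR (to_measurableTypeR f)
    (@measurable_funPT _ _ T R f).

Definition Lclass_quot (f : LfunType mu p1) : {mfun_ mu, T >-> mR} :=
  (\pi_({mfun_ mu, T >-> mR}) (to_measurableTypeR f : {mfun T >-> mR}))%qT.

Lemma Lclass_quot_ae (f : LfunType mu p1) :
  (Lclass_quot f : T -> R) = f %[ae mu].
Proof.
rewrite /aqEqMfun_to_fun.
have /eqmodP/asboolP : (repr (Lclass_quot f) =
    (to_measurableTypeR f : {mfun T >-> mR}) %[mod {mfun_ mu, T >-> mR}])%qT.
  by rewrite reprK.
by [].
Qed.

Lemma Lspace_mfun_subproof (f : {mfun_ mu, T >-> mR}) :
  (f : T -> R) \in @mfun _ _ T R.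
Proof. by rewrite inE; exact: (@measurable_funPT _ _ _ _ (repr f)). Qed.

Lemma Lclass_subproof (f : LfunType mu p1) : finite_norm mu p (Lclass_quot f).
Proof.
rewrite /finite_norm.
pose g := mfun_Sub (Lspace_mfun_subproof (Lclass_quot f)).
rewrite (@ae_eq_Lnorm g f); first exact: Lfunction_finite.
exact: Lclass_quot_ae.
Qed.

HB.instance Definition _ (f : LfunType mu p1) :=
  @isFinLebesgue.Build _ T R mu p p1 (Lclass_quot f) (Lclass_subproof f).

Definition Lclass (f : LfunType mu p1) : Lp := Lclass_quot f.

Lemma LclassE (f : LfunType mu p1) : (Lclass f : T -> R) = f %[ae mu].
Proof. exact: Lclass_quot_ae. Qed.

Lemma LspaceP (f g : Lp) : (f : T -> R) = g %[ae mu] -> f = g.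
Proof.
case: f g => [f [[cf]]] [g [[cg]]] /= fg.
have {}fg : f = g.
  by rewrite -[f]reprK -[g]reprK; apply/eqmodP/asboolP; exact: fg.
move: cf cg; rewrite fg => cf cg.
by rewrite (Prop_irrelevance cf cg).
Qed.

Lemma Lrepr_subproof (f : Lp) : (f : T -> R) \in Lfun mu p.
Proof.
apply/andP; split; first exact: Lspace_mfun_subproof.
by rewrite inE; exact: Lebesgue_finite.
Qed.

Definition Lrepr (f : Lp) : LfunType mu p1 := Lfun_Sub p1 (Lrepr_subproof f).

Lemma LclassK (f : Lp) : Lclass (Lrepr f) = f.
Proof. by apply: LspaceP; exact: LclassE. Qed.

Lemma Lclass_eq (f g : LfunType mu p1) : (f : T -> R) = g %[ae mu] ->
  Lclass f = Lclass g.
Proof.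
move=> fg; apply: LspaceP.
by apply: ae_eq_trans (LclassE f) _; apply: ae_eq_trans fg (ae_eq_sym (LclassE g)).
Qed.

Let Ladd (f g : Lp) := Lclass (Lrepr f + Lrepr g).
Let Lopp (f : Lp) := Lclass (- Lrepr f).
Let Lscale (a : R) (f : Lp) := Lclass (a *: Lrepr f).

Let LaddE (f g : LfunType mu p1) : Ladd (Lclass f) (Lclass g) = Lclass (f + g).
Proof.
apply: Lclass_eq; near=> x => _ /=.
congr (_ + _).
  by near: x; apply: filterS (LclassE f) => x /(_ Logic.I).
by near: x; apply: filterS (LclassE g) => x /(_ Logic.I).
Unshelve. all: by end_near. Qed.

Let LoppE (f : LfunType mu p1) : Lopp (Lclass f) = Lclass (- f).
Proof.
by apply: Lclass_eq; apply: filterS (LclassE f) => x /(_ Logic.I) fx _; congr (- _).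
Qed.

Let LscaleE a (f : LfunType mu p1) : Lscale a (Lclass f) = Lclass (a *: f).
Proof.
by apply: Lclass_eq; apply: filterS (LclassE f) => x /(_ Logic.I) fx _; congr (_ * _).
Qed.

Let LaddA : associative Ladd.
Proof.
by move=> f g h; rewrite -(LclassK f) -(LclassK g) -(LclassK h) !LaddE addrA.
Qed.

Let LaddC : commutative Ladd.
Proof. by move=> f g; rewrite /Ladd addrC. Qed.

Let Ladd0 : left_id (Lclass 0) Ladd.
Proof. by move=> f; rewrite -(LclassK f) LaddE add0r. Qed.

Let LaddN : left_inverse (Lclass 0) Lopp Ladd.
Proof. by move=> f; rewrite -(LclassK f) LoppE LaddE addNr. Qed.

HB.instance Definition _ := GRing.isZmodule.Build Lp LaddA LaddC Ladd0 LaddN.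

Lemma LclassD (f g : LfunType mu p1) : Lclass (f + g) = Lclass f + Lclass g.
Proof. exact: Logic.eq_sym (LaddE f g). Qed.

Let LscaleA a b (f : Lp) : Lscale a (Lscale b f) = Lscale (a * b) f.
Proof. by rewrite -(LclassK f) !LscaleE scalerA. Qed.

Let Lscale1 : left_id 1 Lscale.
Proof. by move=> f; rewrite -(LclassK f) LscaleE scale1r. Qed.

Let LscaleDr : right_distributive Lscale +%R.
Proof.
move=> a f g; rewrite -(LclassK f) -(LclassK g) -LclassD !LscaleE -LclassD.
by rewrite scalerDr.
Qed.

Let LscaleDl (f : Lp) : {morph Lscale^~ f : a b / a + b}.
Proof. by move=> a b; rewrite -(LclassK f) !LscaleE -LclassD scalerDl. Qed.

HB.instance Definition _ := GRing.Zmodule_isLmodule.Build R Lp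
  LscaleA Lscale1 LscaleDr LscaleDl.

Lemma LclassZ a (f : LfunType mu p1) : Lclass (a *: f) = a *: Lclass f.
Proof. exact: Logic.eq_sym (LscaleE a f). Qed.

Definition Lspace_norm (f : Lp) : R := fine ('N[mu]_p[EFin \o f])%E.

Lemma Lspace_normE (f : LfunType mu p1) :
  Lspace_norm (Lclass f) = fine ('N[mu]_p[EFin \o f])%E.
Proof. by congr fine; apply: (@ae_eq_Lnorm (Lrepr (Lclass f)) f); exact: LclassE. Qed.

Let Lspace_normD (f g : Lp) :
  Lspace_norm (f + g) <= Lspace_norm f + Lspace_norm g.
Proof.
rewrite -(LclassK f) -(LclassK g) -LclassD !Lspace_normE; exact: ler_LnormD.
Qed.

Let Lspace_normZ a (f : Lp) : Lspace_norm (a *: f) = `|a| * Lspace_norm f.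
Proof.
rewrite -(LclassK f) -LclassZ !Lspace_normE.
apply/EFin_inj; rewrite EFinM !finite_norm_fine; exact: LnormZ.
Qed.

Let Lspace_norm_eq0 (f : Lp) : Lspace_norm f = 0 -> f = 0.
Proof.
rewrite -(LclassK f) Lspace_normE => /fine_Lnormr_eq0 f0.
by rewrite [RHS](_ : _ = Lclass 0)//; apply: Lclass_eq.
Qed.

HB.instance Definition _ := Lmodule_isNormed.Build R Lp
  Lspace_normD Lspace_normZ Lspace_norm_eq0.

End Lspace_normedModType.

Section C01.
Variable R : realType.
Local Notation I01 := `[0%R, 1%R : R]%classic.

(* A continuous function on [0, 1] is represented by its extension by 0 to R,
   which makes the representation unique. *)
Definition continuous01 : {pred R -> R} :=
  mem [set f | {within I01, continuous f} /\ forall t, ~ I01 t -> f t = 0].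

Record C01 := MkC01 { C01_fun :> R -> R ; _ : C01_fun \in continuous01 }.

HB.instance Definition _ := [isSub for C01_fun].
HB.instance Definition _ := [Choice of C01 by <:].

Let continuous01_submod_closed : submod_closed continuous01.
Proof.
split.
  by rewrite inE; split=> // t; exact: cvg_cst.
move=> a f g; rewrite !inE => -[cf f0] [cg g0]; split=> [|t tI].
  move=> t; apply: cvgD; last exact: cg.
  by apply: cvgM; [exact: cvg_cst|exact: cf].
by rewrite [LHS](_ : _ = a * f t + g t)// f0// g0// addr0 mulr0.
Qed.

HB.instance Definition _ :=
  GRing.isSubmodClosed.Build R (R -> R) continuous01 continuous01_submod_closed.
HB.instance Definition _ := [SubChoice_isSubLmodule of C01 by <:].

Definition sup_norm (f : C01) : R := sup [set `|f t| | t in I01].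

Lemma C01_continuous (f : C01) : {within I01, continuous f}.
Proof. by case: f => f /=; rewrite inE => -[]. Qed.

Lemma C01_out (f : C01) t : ~ I01 t -> f t = 0.
Proof. by case: f => f /=; rewrite inE => -[_]; exact. Qed.

Let sup_norm_has_sup (f : C01) : has_sup [set `|f t| | t in I01].
Proof.
split; first by exists `|f 0|; exists 0; rewrite //= in_itv/= lexx ler01.
have cf : {within I01, continuous (fun t => `|f t|)}.
  by move=> t; apply: cvg_norm; exact: C01_continuous.
have [c _ fc] := EVT_max ler01 cf.
by exists `|f c| => _ [t It <-]; exact: fc.
Qed.

Lemma le_sup_norm (f : C01) t : `|f t| <= sup_norm f.
Proof.
have [It|It] := pselect (I01 t).
  by apply: sup_upper_bound; [exact: sup_norm_has_sup|exists t].
rewrite C01_out// normr0 (le_trans (normr_ge0 (f 0)))//.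
apply: sup_upper_bound; first exact: sup_norm_has_sup.
by exists 0; rewrite //= in_itv/= lexx ler01.
Qed.

Lemma sup_norm_le (f : C01) M : (forall t, I01 t -> `|f t| <= M) -> sup_norm f <= M.
Proof.
move=> fM; apply: ge_sup; first by case: (sup_norm_has_sup f).
by move=> _ [t It <-]; exact: fM.
Qed.

Let sup_normD (f g : C01) : sup_norm (f + g) <= sup_norm f + sup_norm g.
Proof.
apply: sup_norm_le => t _; apply: le_trans (ler_normD _ _) _.
by apply: lerD; exact: le_sup_norm.
Qed.

Let sup_norm_scale_le a (f : C01) : sup_norm (a *: f) <= `|a| * sup_norm f.
Proof.
apply: sup_norm_le => t _; rewrite [X in `|X|](_ : _ = a * f t)// normrM.
by rewrite ler_wpM2l// le_sup_norm.
Qed.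

Let sup_normZ a (f : C01) : sup_norm (a *: f) = `|a| * sup_norm f.
Proof.
apply/le_anti; rewrite sup_norm_scale_le/=.
have [->|a0] := eqVneq a 0.
  by rewrite normr0 mul0r (le_trans (normr_ge0 ((0 *: f : C01) 0)))// le_sup_norm.
rewrite -ler_pdivlMl ?normr_gt0// -normfV.
by rewrite -[X in sup_norm X <= _](@scalerK _ _ _ a0) sup_norm_scale_le.
Qed.

Let sup_norm_eq0 (f : C01) : sup_norm f = 0 -> f = 0.
Proof.
move=> f0; apply/val_inj/funext => t /=; apply/normr0_eq0/le_anti.
by rewrite normr_ge0 andbT -f0 le_sup_norm.
Qed.

HB.instance Definition _ := Lmodule_isNormed.Build R C01
  sup_normD sup_normZ sup_norm_eq0.

Definition leb01 : {measure set (measurableTypeR R) -> \bar R} :=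
  mrestr lebesgue_measure (measurable_itv `[0%R, 1%R : R]).

(* L^2[0, 1], as L^2(R) for Lebesgue measure restricted to [0, 1]. *)
Definition L201 := LspaceType2 leb01.

End C01.

(* A normed space with its Borel sigma-algebra. *)
Notation borel E := (g_sigma_algebraType (@open E)).

Section borel.
Context {R : realType}.
Implicit Types E F : normedModType R.

Lemma continuous_borel E F (f : E -> F) : continuous f ->
  @measurable_fun _ _ (borel E) (borel F) setT f.
Proof.
move=> cf; apply: (@measurability _ _ _ (borel F) _ _ (@open F)) => //.
move=> _ [B oB <-]; rewrite setTI; apply: sub_sigma_algebra.
by move/continuousP : cf; exact.
Qed.

Lemma contraction_continuous E F (f : E -> F) :
  (forall x y, `|f x - f y| <= `|x - y|) -> continuous f.
Proof.
move=> fC x; apply/cvgrPdist_lt => e e0; near=> y.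
apply: le_lt_trans (fC _ _) _; near: y; exact: cvgr_dist_lt.
Unshelve. all: by end_near. Qed.

Lemma norm_borel E : @measurable_fun _ _ (borel E) R setT (fun x : E => `|x|).
Proof.
apply: (measurability _ (RGenOpens.measurableE R)).
move=> _ [_ [a [b ->] <-]]; rewrite setTI; apply: sub_sigma_algebra.
have /continuousP := @norm_continuous R E; apply; exact: interval_open.
Qed.

Definition dilate E (r : R) (x : borel E) : borel E := r *: (x : E).
Arguments dilate {E} r x.

Lemma dilate_borel E (r : R) : @measurable_fun _ _ (borel E) (borel E) setT (@dilate E r).
Proof. by apply: continuous_borel => x; exact: scaler_continuous. Qed.

HB.instance Definition _ E (r : R) :=
  isMeasurableFun.Build _ _ (borel E) (borel E) (@dilate E r) (@dilate_borel E r).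

(* `normalize 0 = 0`. *)
Definition normalize E (x : borel E) : borel E := `|x : E|^-1 *: (x : E).
Arguments normalize {E} x.

Lemma normalize_borel E : @measurable_fun _ _ (borel E) (borel E) setT (@normalize E).
Proof.
apply: (@measurability _ _ _ (borel E) _ _ (@open E)) => //.
move=> _ [B oB <-]; rewrite setTI.
have o0 : open (~` [set (0 : E)]).
  by apply: closed_openC; exact/accessible_closed_set1/hausdorff_accessible/norm_hausdorff.
have -> : @normalize E @^-1` B =
    (normalize @^-1` B `&` ~` [set (0 : E)]) `|` (normalize @^-1` B `&` [set (0 : E)]).
  by rewrite -setIUr setUC setUv ?setIT.
apply: measurableU.
  apply: sub_sigma_algebra; rewrite openE => x [Bx x0].
  have {}x0 : x != (0 : E) by apply/eqP.
  apply: filterI; last by apply: open_nbhs_nbhs; split=> //; apply/eqP.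
  have : `|y|^-1 *: y @[y --> (x : E)] --> `|x : E|^-1 *: (x : E).
    apply: cvgZ => //; apply: cvgV; first by rewrite normr_eq0.
    exact: norm_continuous.
  by apply; apply: open_nbhs_nbhs.
have m0 : measurable ([set (0 : E)] : set (borel E)).
  rewrite -[X in measurable X]setCK; apply: measurableC.
  exact: sub_sigma_algebra.
have [|] := pselect ((normalize @^-1` B) (0 : E)) => h.
  by rewrite setIidr// => _ ->.
rewrite (_ : _ `&` _ = set0)//; apply/seteqP; split=> // x [+ /= x0].
by rewrite x0.
Qed.

HB.instance Definition _ E :=
  isMeasurableFun.Build _ _ (borel E) (borel E) (@normalize E) (@normalize_borel E).

End borel.
Arguments dilate {R E} r x.
Arguments normalize {R E} x.

Section L2_of_C01.
Variable R : realType.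

Let one2 : (1 <= 2 :> \bar R)%E := lee1n 2.

Lemma C01_measurable (f : C01 R) : measurable_fun [set: measurableTypeR R] f.
Proof.
have -> : (f : R -> R) = f \_ `[0%R, 1%R : R]%classic.
  apply/funext => t; rewrite patchE; case: ifPn => // /negP tI.
  by apply: C01_out => It; apply: tI; rewrite inE.
apply: (measurable_restrictT _ _).1 => //.
by apply: subspace_continuous_measurable_fun => //; exact: C01_continuous.
Qed.

Lemma C01_Lnorm_le (f : C01 R) : ('N[leb01 R]_2[EFin \o f] <= `|f|%:E)%E.
Proof.
have leb1 : leb01 R setT = 1%E.
  by rewrite /leb01 /= /mrestr setTI lebesgue_measure_itv/= lte01 oppr0 adde0.
rewrite unlock /Lnorm/=.
have -> : `|f|%:E = ((\int[leb01 R]_x ((`|f| `^ 2)%:E : \bar R)) `^ 2^-1)%E.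
  rewrite integral_cst// leb1 mule1 poweR_EFin -powRrM mulfV ?pnatr_eq0//.
  by rewrite powRr1.
apply: gt0_ler_poweR; rewrite ?in_itv/= ?invr_gt0 ?ltr0n ?leey ?integral_ge0//=.
apply: ge0_le_integral => //=.
- apply/measurable_EFinP; apply: (measurableT_comp (measurable_powR _)).
  by apply: measurableT_comp => //; exact: C01_measurable.
- by move=> x _; rewrite lee_fin ge0_ler_powR ?nnegrE ?le_sup_norm.
Qed.

Lemma C01_Lfun (f : C01 R) : (f : R -> R) \in Lfun (leb01 R) 2%:E.
Proof.
apply/andP; split; first by rewrite inE; exact: C01_measurable.
by rewrite inE; apply: le_lt_trans (C01_Lnorm_le f) _; rewrite ltry.
Qed.

Definition L2_of_C01 (f : borel (C01 R)) : borel (L201 R) :=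
  Lclass (Lfun_Sub one2 (C01_Lfun f)).

Lemma L2_of_C01B (f g : C01 R) :
  L2_of_C01 (f - g) = (L2_of_C01 f : L201 R) - (L2_of_C01 g : L201 R).
Proof.
rewrite /L2_of_C01 -[X in _ = _ + X]scaleN1r -LclassZ -LclassD; apply: Lclass_eq.
apply: nearW => x _ /=.
by rewrite [LHS](_ : _ = f x - g x)// [RHS](_ : _ = f x + -1 * g x)// mulN1r.
Qed.

Lemma L2_of_C01_le (f : C01 R) : `|L2_of_C01 f : L201 R| <= `|f|.
Proof.
rewrite [leLHS]Lspace_normE -lee_fin fineK.
  exact: C01_Lnorm_le.
by rewrite ge0_fin_numE ?Lnorm_ge0//; apply: le_lt_trans (C01_Lnorm_le f) _; rewrite ltry.
Qed.

Lemma L2_of_C01_continuous : continuous (L2_of_C01 : C01 R -> L201 R).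
Proof.
by apply: contraction_continuous => f g; rewrite -L2_of_C01B; exact: L2_of_C01_le.
Qed.

Lemma L2_of_C01_measurable :
  @measurable_fun _ _ (borel (C01 R)) (borel (L201 R)) setT L2_of_C01.
Proof. exact: continuous_borel L2_of_C01_continuous. Qed.

HB.instance Definition _ :=
  isMeasurableFun.Build _ _ (borel (C01 R)) (borel (L201 R))
    L2_of_C01 L2_of_C01_measurable.

End L2_of_C01.
Arguments L2_of_C01 {R} f.

Definition regularly_varying_fun {R : realType} (b : R -> R) (rho : R) : Prop :=
  measurable_fun (`]0, +oo[%classic : set R) b /\
  forall x, 0 < x -> b (t * x) / b t @[t --> +oo] --> x `^ rho.

Section regular_variation.
Context {R : realType}.
Implicit Type E : normedModType R.

Definition punctured E : set (borel E) := [set~ (0 : E)].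
Arguments punctured : clear implicits.

(* A function on E \ {0} that vanishes in a punctured neighborhood of 0 is
   identified with its extension by 0 to E, which is continuous at 0. *)
Definition C0_fun E (f : E -> R) : Prop :=
  [/\ continuous f, bounded_fun f & \forall x \near (0 : E), f x = 0].

(* A Borel measure on E \ {0} is identified with the Borel measure on E that
   extends it and does not charge {0}. *)
Definition M0 E (mu : {measure set (borel E) -> \bar R}) : Prop :=
  mu [set (0 : E)] = 0%E /\
  forall (A : set (borel E)) (e : R), measurable A -> 0 < e ->
    (forall x : E, A x -> e <= `|x|) -> (mu A < +oo)%E.

Definition M0_cvg E (mu_ : nat -> {measure set (borel E) -> \bar R})
    (mu : {measure set (borel E) -> \bar R}) : Prop :=
  forall f : E -> R, C0_fun f ->
    (\int[mu_ n]_(x in punctured E) (f x)%:E)%E @[n --> \oo] -->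
    (\int[mu]_(x in punctured E) (f x)%:E)%E.

(* The image measure of P by n^-1 X is the set function A |-> P (X \in n A).
   The values of b are nonnegative so that b(n) P (X \in n .) is a measure;
   its possible atom at 0 is discarded by `M0_cvg`. *)
Definition regularly_varying E d (Omega : measurableType d)
    (P : probability Omega R) (X : {RV P >-> borel E}) (alpha : R) : Prop :=
  exists (mu : {measure set (borel E) -> \bar R}) (b : R -> {nonneg R}),
  [/\ M0 mu, mu (punctured E) != 0%E,
      exists rho : R, regularly_varying_fun (fun t => (b t)%:num) rho,
      M0_cvg
        (fun n => mscale (b n%:R) (distribution P (dilate n%:R^-1 \o X))) mu
    & forall (t : R) (A : set (borel E)), 0 < t -> measurable A ->
        A `<=` punctured E ->
        mu [set t *: (x : E) | x in A] = ((t `^ (- alpha))%:E * mu A)%E].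

Definition weak_cvg E (I : Type) (F : set_system I)
    (nu_ : I -> probability (borel E) R) (nu : probability (borel E) R) : Prop :=
  forall g : E -> R, continuous g -> bounded_fun g ->
    (\int[nu_ i]_x (g x)%:E)%E @[i --> F] --> (\int[nu]_x (g x)%:E)%E.

Section angular.
Context E d (Omega : measurableType d) (P : probability Omega R).
Variable X : {RV P >-> borel E}.

Definition exceedance (t : R) : set Omega := [set w | t < `|X w : E|].

Lemma measurable_exceedance t : measurable (exceedance t).
Proof.
have mN : measurable_fun setT (fun w => `|X w : E|).
  exact: (measurableT_comp (@norm_borel R E) (measurable_funPT X)).
have := mN measurableT _ (measurable_itv `]t, +oo[).
by rewrite setTI; congr measurable; apply/seteqP; split=> w /=; rewrite in_itv/= andbT.
Qed.

(* The law of X / `|X| under P( . | `|X| > t); if P(`|X| > t) = 0, `mnormalize`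
   returns its default value P instead of the conditional probability. *)
Definition angular_law (t : R) : probability (borel E) R :=
  distribution (mnormalize (mrestr P (measurable_exceedance t)) P)
    (normalize \o X).

Definition angular_limit (nu : probability (borel E) R) : Prop :=
  weak_cvg (pinfty_nbhs R) angular_law nu.

End angular.
End regular_variation.
Arguments regularly_varying {R E d Omega} P X alpha.
Arguments angular_limit {R E d Omega} P X nu.

(* Main.v *)
Require Import Defs.
From HB Require Import structures.
From mathcomp Require Import all_boot all_order all_algebra.
From mathcomp Require Import all_classical all_reals all_analysis.
From mathcomp Require Import measurable_realfun ring lra.

Set Implicit Arguments.
Unset Strict Implicit.
Unset Printing Implicit Defensive.

Import Order.TTheory GRing.Theory Num.Theory numFieldNormedType.Exports.

Local Open Scope classical_set_scope.
Local Open Scope ring_scope.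

(* The embedding T of C[0, 1] in L^2[0, 1] is continuous, homogeneous, injective
   and contracting, so it pushes the limit measure mu of X forward to a limit
   measure of T X. In any normed space the angular limit of a regularly varying
   element is the normalization of the angular measure
     sigma A = mu {x | |x| > 1 and x / |x| in A},
   and it is unique. Homogeneity makes mu a product in polar coordinates, whence
     mu {x | |T x| > 1 and T x / |T x| in B} =
     \int |T theta|^alpha 1_B (T theta / |T theta|) d sigma(theta). *)

(** Regular variation is tested along integers, on continuous functions that vanish near 0, whereas
    the angular limit runs along real [t] and conditions on [|X| > t], whose indicator is
    discontinuous. Continuous ramps in the norm squeeze this indicator from both sides. Homogeneity
    of mu makes the loss small when the two levels of the ramp are close, and monotonicity of the
    tails carries the limit from integers to reals. The factor [b] is the same for every test
    function, so it cancels in a conditional expectation. The weight |T theta|^alpha arises because,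
    in the direction theta, |T x| > 1 means |x| > 1 / |T theta|, and homogeneity gives this ray the
    mass |T theta|^alpha. The limit theorem is used in both spaces: over C[0, 1] it identifies the
    law of Theta with sigma divided by its total mass, over L^2 it identifies the law sought. The
    total mass of sigma then cancels between numerator and denominator. *)

Lemma ge0_integral_mrestr d (T : measurableType d) (R : realType)
    (m : {measure set T -> \bar R}) (D : set T) (mD : measurable D)
    (f : T -> \bar R) :
  measurable_fun setT f -> (forall x, 0 <= f x)%E ->
  (\int[mrestr m mD]_x f x = \int[m]_(x in D) f x)%E.
Proof.
move=> mf f0.
have mDC : measurable (~` D) by exact: measurableC.
have D0 : mrestr m mD (~` D) = 0 by rewrite /mrestr setICl measure0.
rewrite (ge0_negligible_integral mDC _ _ _ D0)//.
rewrite setTD setCK; apply: eq_measure_integral => A mA AD.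
by rewrite /= /mrestr setIidl.
Qed.

(** * Borel probabilities are determined by continuous functions *)

Section borel_measures.
Context {R : realType}.
Implicit Types E : normedModType R.

Lemma continuous_measurable_borel E (f : E -> R) : continuous f ->
  measurable_fun [set: borel E] (f : borel E -> R).
Proof.
move=> cf; apply: (measurability _ (RGenOpens.measurableE R)).
move=> _ [_ [a [b ->] <-]]; rewrite setTI; apply: sub_sigma_algebra.
by move/continuousP : cf; apply; exact: interval_open.
Qed.

Definition set_dist E (A : set E) (x : E) : R := inf [set `|x - a| | a in A].

Lemma set_dist_le E (A : set E) (x a : E) : A a -> set_dist A x <= `|x - a|.
Proof.
move=> Aa; apply: ge_inf; last by exists a.
by exists 0 => _ [? _ <-].
Qed.

Lemma set_dist_ge0 E (A : set E) (x : E) : 0 <= set_dist A x.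
Proof.
have [->|/set0P[a Aa]] := eqVneq A set0.
  by rewrite /set_dist image_set0 inf0.
by apply: lb_le_inf; [exists `|x - a|; exists a|move=> _ [? _ <-]].
Qed.

Lemma set_dist_continuous E (A : set E) : A !=set0 -> continuous (set_dist A).
Proof.
move=> [a0 Aa0].
have tri x y : set_dist A x <= `|x - y| + set_dist A y.
  rewrite -lerBlDl; apply: lb_le_inf; first by exists `|y - a0|; exists a0.
  move=> _ [a Aa <-]; rewrite lerBlDl; apply: le_trans (set_dist_le x Aa) _.
  by rewrite -(subrKA y) ler_normD.
move=> x; apply/cvgrPdist_lt => e e0; near=> y.
apply: (@le_lt_trans _ _ `|x - y|); last by near: y; exact: cvgr_dist_lt.
by rewrite ler_distl lerBlDl [_ + `|_|]addrC tri distrC tri.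
Unshelve. all: by end_near. Qed.

Lemma set_dist_gt0 E (U : set E) (x : E) : open U -> U x -> ~` U !=set0 ->
  0 < set_dist (~` U) x.
Proof.
move=> oU Ux [a0 Ua0].
have : nbhs x U by exact: open_nbhs_nbhs.
move=> /nbhs_ballP[e /= e0 xU]; apply: (lt_le_trans e0).
apply: lb_le_inf; first by exists `|x - a0|; exists a0.
move=> _ [a Ua <-]; rewrite leNgt; apply/negP => xa; apply: Ua.
by apply: xU; rewrite -ball_normE.
Qed.

(** The open sets form a pi-system generating the Borel sets, and the indicator of an open U is the
    increasing limit of the continuous functions min(1, n d(x, U^c)). *)
Lemma probability_borel_unique E (P Q : probability (borel E) R) :
  (forall (g : E -> R), continuous g -> (forall x, 0 <= g x <= 1) ->
    (\int[P]_x (g x)%:E = \int[Q]_x (g x)%:E)%E) ->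
  forall A, measurable A -> P A = Q A.
Proof.
move=> PQ A; apply: (@measure_unique _ R (borel E) (@open E) (fun=> setT) _ _ _ _ P Q) => //.
- by move=> U V; exact: openI.
- by move=> ?; exact: openT.
- by rewrite bigcup_const//; exists 0%N.
- move=> U oU.
  (* The whole space is treated apart: since [inf set0 = 0], the distance to its empty complement is
     0, and the approximation below would vanish. *)
  have [U0|/set0P U0] := eqVneq (~` U) set0.
    have -> : U = [set: borel E] by rewrite -(setCK U) U0 setC0.
    exact: etrans (probability_setT P) (esym (probability_setT Q)).
  pose f (n : nat) (x : E) : R := Num.min 1 (n%:R * set_dist (~` U) x).
  have cf n : continuous (f n).
    move=> x; apply: (@continuous_min _ _ (cst 1) (fun x => n%:R * set_dist (~` U) x)).
      exact: cvg_cst.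
    by apply: cvgM; [exact: cvg_cst|exact: set_dist_continuous].
  have f01 n x : 0 <= f n x <= 1.
    by rewrite /f le_min ge_min ler01 lexx/= mulr_ge0// set_dist_ge0.
  have mU : measurable (U : set (borel E)) by exact: sub_sigma_algebra.
  have fU (M : probability (borel E) R) :
      (\int[M]_x (f n x)%:E @[n --> \oo] --> M U)%E.
    rewrite -[X in _ --> M X]setIT -integral_indic//.
    have -> : (\int[M]_x (\1_U x)%:E = \int[M]_x limn (fun n => (f n x)%:E))%E.
      apply: eq_integral => x _; apply/esym/cvg_lim => //.
      apply: cvg_near_cst; rewrite indicE.
      case: (boolP (x \in U)) => [/set_mem Ux|/negP xU].
        have d0 := set_dist_gt0 oU Ux U0.
        near=> n; apply/eqP; rewrite eqe eq_le ge_min lexx/=.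
        rewrite le_min lexx/= -ler_pdivrMr// mul1r.
        by near: n; exact: nbhs_infty_ger.
      near=> n; apply/eqP; rewrite eqe eq_le; apply/andP; split.
        rewrite ge_min; apply/orP; right.
        have Ux : (~` U) x by move=> Ux; apply: xU; rewrite inE.
        apply: le_trans (ler_wpM2l (ler0n _ n) (set_dist_le x Ux)) _.
        by rewrite subrr normr0 mulr0.
      by case/andP: (f01 n x).
    apply: cvg_monotone_convergence => //.
    + move=> n; apply/measurable_EFinP.
      exact: continuous_measurable_borel.
    + by move=> n x _; rewrite lee_fin; case/andP: (f01 n x).
    + move=> x _ m n mn; rewrite lee_fin /f le_min ge_min lexx/=.
      rewrite ge_min; apply/orP; right.
      by rewrite ler_wpM2r ?ler_nat// set_dist_ge0.
  have fPQ : (fun n => \int[P]_x (f n x)%:E)%E = (fun n => \int[Q]_x (f n x)%:E)%E.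
    by apply/funext => n; exact: PQ.
  have := fU P; rewrite fPQ => fP.
  exact: (cvg_unique _ fP (fU Q)).
- by move=> _; apply: le_lt_trans (probability_le1 P _) _; rewrite ?ltry.
Unshelve. all: by end_near. Qed.

End borel_measures.

(** * Image measures *)

Section image_measure.
Context d1 d2 (T1 : measurableType d1) (T2 : measurableType d2) (R : realType).
Variables (m : {measure set T1 -> \bar R}) (f : {mfun T1 >-> T2}).

(** Taking [f] as a bundled measurable function lets the pushforward be inferred to be a measure. *)
Definition image_measure : set T2 -> \bar R := pushforward m f.

Let image_measure0 : image_measure set0 = 0%E.
Proof. exact: measure0. Qed.

Let image_measure_ge0 A : (0 <= image_measure A)%E.
Proof. exact: measure_ge0. Qed.

Let image_measure_sigma_additive : semi_sigma_additive image_measure.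
Proof. exact: measure_semi_sigma_additive. Qed.

HB.instance Definition _ := isMeasure.Build _ _ _ image_measure
  image_measure0 image_measure_ge0 image_measure_sigma_additive.

Lemma ge0_integral_image_measure (g : T2 -> \bar R) :
  measurable_fun setT g -> (forall x, 0 <= g x)%E ->
  (\int[image_measure]_x g x = \int[m]_x g (f x))%E.
Proof. by move=> mg g0; rewrite ge0_integral_pushforward. Qed.

End image_measure.

(** * Tail integrals and continuous cutoffs *)

Section tails.
Context {R : realType}.
Implicit Types E : normedModType R.

Definition outside E (s : R) : set (borel E) := [set x | s < `|x : E|].
Arguments outside : clear implicits.

Lemma measurable_outside E s : measurable (outside E s).
Proof.
have := @norm_borel R E measurableT _ (measurable_itv `]s, +oo[).
by rewrite setTI; congr measurable; apply/seteqP; split=> x /=; rewrite in_itv/= andbT.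
Qed.

Lemma measurable_punctured E : measurable (@punctured R E).
Proof.
have -> : @punctured R E = outside E 0.
  by apply/seteqP; split=> x /=; rewrite /punctured /outside/= normr_gt0 => /eqP.
exact: measurable_outside.
Qed.

Lemma normalizeZ E (r : R) (x : borel E) : 0 < r ->
  normalize (r *: (x : E) : borel E) = normalize x.
Proof.
move=> r0; rewrite /normalize normrZ scalerA gtr0_norm//.
by rewrite invfM mulrC mulrA divff ?mul1r// gt_eqF.
Qed.

Lemma normrM_normalize E (x : borel E) :
  `|x : E| *: (normalize x : E) = x.
Proof.
rewrite /normalize scalerA; have [->|x0] := eqVneq (x : E) 0.
  by rewrite scaler0.
by rewrite divff ?scale1r// normr_eq0.
Qed.

(** The level [s] stays a parameter so that homogeneity of [m] becomes a scaling law in [s]; level 1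
    gives sigma. *)
Definition angular_measure E (m : {measure set (borel E) -> \bar R}) (s : R)
    : {measure set (borel E) -> \bar R} :=
  image_measure (mrestr m (@measurable_outside E s)) normalize.

Lemma angular_measureE E (m : {measure set (borel E) -> \bar R}) s A :
  angular_measure m s A = m (normalize @^-1` A `&` outside E s).
Proof. by []. Qed.

(** For [m] the law of X, dividing by the value at [g = 1], when positive, gives the integral of [g]
    against the conditional law of X / |X| given |X| > s. *)
Definition tail_integral E (m : {measure set (borel E) -> \bar R})
    (g : E -> R) (s : R) : \bar R :=
  (\int[m]_(x in outside E s) (g (normalize x))%:E)%E.

Lemma measurable_normalize_comp E (g : E -> R) :
  measurable_fun setT (g : borel E -> R) ->
  measurable_fun setT (fun x : borel E => (g (normalize x))%:E).
Proof.
move=> mg; apply/measurable_EFinP.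
exact: (measurableT_comp mg (@measurable_funPT _ _ _ _ (@normalize R E))).
Qed.

Section fixed_integrand.
Context E (m : {measure set (borel E) -> \bar R}) (g : E -> R).
Hypothesis mg : measurable_fun setT (g : borel E -> R).
Hypothesis g0 : forall x, 0 <= g x.

Let mgn := measurable_normalize_comp mg.

Lemma tail_integral_angular s :
  tail_integral m g s = (\int[angular_measure m s]_x (g x)%:E)%E.
Proof.
have mEg : measurable_fun setT (fun x : borel E => (g x)%:E).
  exact/measurable_EFinP.
rewrite ge0_integral_image_measure// ge0_integral_mrestr//.
by move=> x; rewrite lee_fin.
Qed.

Lemma tail_integral_ge0 s : (0 <= tail_integral m g s)%E.
Proof. by apply: integral_ge0 => x _; rewrite lee_fin. Qed.

Lemma tail_integral_le s t : s <= t ->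
  (tail_integral m g t <= tail_integral m g s)%E.
Proof.
move=> st; apply: ge0_subset_integral.
- exact: measurable_outside.
- exact: measurable_outside.
- exact: measurable_funTS.
- by move=> x _; rewrite lee_fin.
- by move=> x; exact: le_lt_trans.
Qed.

Lemma tail_integral_bounded M s : (forall x, g x <= M) ->
  (tail_integral m g s <= M%:E * m (outside E s))%E.
Proof.
move=> gM; rewrite -[leRHS]integral_cst; last exact: measurable_outside.
apply: ge0_le_integral.
- exact: measurable_outside.
- by move=> x _; rewrite lee_fin.
- exact: measurable_funTS.
- exact: measurable_cst.
- by move=> x _; rewrite lee_fin.
Qed.

End fixed_integrand.

(** For s < t this continuous cutoff lies between the indicators of [outside E t] and
    [outside E s]. *)
Definition ramp E (s t : R) (x : E) : R :=
  Num.min 1 (Num.max 0 ((`|x| - s) / (t - s))).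

Lemma ramp_ge0 E s t (x : E) : 0 <= ramp s t x.
Proof. by rewrite /ramp le_min ler01 le_max lexx. Qed.

Lemma ramp_le1 E s t (x : E) : ramp s t x <= 1.
Proof. by rewrite /ramp ge_min lexx. Qed.

Lemma ramp_eq0 E s t (x : E) : s < t -> `|x| <= s -> ramp s t x = 0.
Proof.
move=> st xs; rewrite /ramp max_l; first by rewrite min_r.
by rewrite pmulr_lle0 ?subr_le0// invr_gt0 subr_gt0.
Qed.

Lemma ramp_eq1 E s t (x : E) : s < t -> t <= `|x| -> ramp s t x = 1.
Proof.
move=> st tx; rewrite /ramp min_l// le_max; apply/orP; right.
by rewrite ler_pdivlMr ?subr_gt0// mul1r lerB.
Qed.

Lemma ramp_continuous E s t : continuous (@ramp E s t).
Proof.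
move=> x; apply: (@continuous_min _ _ (cst 1)
  (fun y => Num.max 0 ((`|y| - s) / (t - s)))); first exact: cvg_cst.
apply: (@continuous_max _ _ (cst 0) (fun y => (`|y| - s) / (t - s))).
  exact: cvg_cst.
apply: cvgM; last exact: cvg_cst.
by apply: cvgB; [exact: norm_continuous|exact: cvg_cst].
Qed.

(** [normalize] need not be continuous at 0, but the ramp vanishes on the ball of radius s, so the
    product is locally zero there. *)
Lemma ramp_C0_fun E (g : E -> R) (M s t : R) : continuous g ->
  (forall x, 0 <= g x <= M) -> 0 < s < t ->
  C0_fun (fun x : E => g (normalize x) * ramp s t x).
Proof.
move=> cg gM /andP[s0 st].
have near0 : \forall x \near (0 : E), g (normalize x) * ramp s t x = 0.
  have : \forall x \near (0 : E), `|0 - x| < s by exact: cvgr_dist_lt.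
  apply: filterS => x; rewrite sub0r normrN => /ltW xs.
  by rewrite ramp_eq0 ?mulr0.
split=> //.
- move=> x; have [->|x0] := eqVneq x 0.
    apply: cvg_near_cst; rewrite (nbhs_singleton near0); exact: near0.
  apply: cvgM; last exact: ramp_continuous.
  apply: (@continuous_comp _ _ _ (fun x : E => `|x|^-1 *: x) g); last exact: cg.
  apply: cvgZ => //; apply: cvgV; first by rewrite normr_eq0.
  exact: norm_continuous.
- exists M; split; first exact: num_real.
  move=> N MN x _ /=; have /andP[g0 gMx] := gM (normalize x).
  rewrite ger0_norm ?mulr_ge0 ?ramp_ge0//; apply: le_trans (ltW MN).
  by apply: le_trans gMx; rewrite ler_piMr// ramp_le1.
Qed.

Lemma ramp_integral_bounds E (m : {measure set (borel E) -> \bar R})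
    (g : E -> R) (s t : R) : measurable_fun setT (g : borel E -> R) ->
  (forall x, 0 <= g x) -> 0 < s < t ->
  (tail_integral m g t <=
   \int[m]_(x in @punctured R E) (g (normalize x) * ramp s t (x : E))%:E <=
   tail_integral m g s)%E.
Proof.
move=> mg g0 /andP[s0 st].
have mgn := measurable_normalize_comp mg.
pose f (x : borel E) := (g (normalize x) * ramp s t (x : E))%:E.
have f0 x : (0 <= f x)%E by rewrite lee_fin mulr_ge0 ?ramp_ge0.
have mf : measurable_fun setT f.
  apply/measurable_EFinP; apply: measurable_funM; first exact/measurable_EFinP.
  exact: (continuous_measurable_borel (@ramp_continuous E s t)).
have outP r : 0 < r -> outside E r `<=` @punctured R E.
  move=> r0 x; rewrite /outside/= => rx x0; move: rx; rewrite x0 normr0.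
  by rewrite ltNge ltW.
apply/andP; split.
  have -> : tail_integral m g t = (\int[m]_(x in outside E t) f x)%E.
    apply: eq_integral => x /set_mem/ltW tx.
    by rewrite /f (ramp_eq1 st tx) mulr1.
  apply: ge0_subset_integral.
  - exact: measurable_outside.
  - exact: measurable_punctured.
  - exact: measurable_funTS.
  - by move=> x _; exact: f0.
  - by apply: outP; exact: lt_trans st.
have -> : (\int[m]_(x in @punctured R E) f x = \int[m]_(x in outside E s) f x)%E.
  rewrite integral_mkcond [RHS]integral_mkcond; apply: eq_integral => x _.
  rewrite !patchE; have [xs|xs] := boolP (x \in outside E s).
    by rewrite ifT//; apply/mem_set/(outP s s0)/set_mem.
  case: ifPn => // _; rewrite /f ramp_eq0 ?mulr0// leNgt; apply/negP => sx.
  by move/negP : xs; apply; exact/mem_set.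
apply: ge0_le_integral.
- exact: measurable_outside.
- by move=> x _; exact: f0.
- exact: measurable_funTS.
- exact: measurable_funTS.
- by move=> x _; rewrite lee_fin ler_piMr// ramp_le1.
Qed.

End tails.
Arguments outside {R} E s.

(** * Homogeneous limit measures *)

Section homogeneous_measure.
Context {R : realType} (E : normedModType R) (alpha : R).
Variable mu : {measure set (borel E) -> \bar R}.
Hypothesis M0mu : M0 mu.
Hypothesis mu_scale : forall (t : R) (A : set (borel E)), 0 < t ->
  measurable A -> A `<=` @punctured R E ->
  mu [set t *: (x : E) | x in A] = ((t `^ (- alpha))%:E * mu A)%E.

(** Directions are unchanged by positive dilations, so the truncated cone over [A] at level s is s
    times the one at level 1. *)
Lemma angular_measure_scale s A : 0 < s -> measurable A ->
  angular_measure mu s A = ((s `^ (- alpha))%:E * angular_measure mu 1 A)%E.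
Proof.
move=> s0 mA; rewrite !angular_measureE -mu_scale//; last 2 first.
- apply: measurableI; last exact: measurable_outside.
  exact: measurable_funPTI.
- move=> x [_ /=]; rewrite /outside/= => x1 x0; move: x1.
  by rewrite x0 normr0 ltr10.
congr (mu _); apply/seteqP; split=> [x [/= Ax sx]|_ [x [/= Ax x1] <-]].
- exists (s^-1 *: (x : E)); last by rewrite scalerA divff ?scale1r// gt_eqF.
  split; first by rewrite /= normalizeZ// invr_gt0.
  by rewrite /outside/= normrZ gtr0_norm ?invr_gt0// mulrC ltr_pdivlMr// mul1r.
- split; first by rewrite /= normalizeZ.
  by rewrite /outside/= normrZ gtr0_norm// ltr_pMr.
Qed.

Lemma outside_lty s : 0 < s -> (mu (outside E s) < +oo)%E.
Proof.
move=> s0; apply: (M0mu.2 _ s) => //; first exact: measurable_outside.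
by move=> x /ltW.
Qed.

Lemma tail_integral_scale (g : E -> R) s :
  measurable_fun setT (g : borel E -> R) -> (forall x, 0 <= g x) -> 0 < s ->
  tail_integral mu g s = ((s `^ (- alpha))%:E * tail_integral mu g 1)%E.
Proof.
move=> mg g0 s0; rewrite !tail_integral_angular//.
have k0 : 0 <= s `^ (- alpha) by exact: powR_ge0.
have mEg : measurable_fun setT (fun x : borel E => (g x)%:E).
  exact/measurable_EFinP.
rewrite -(@ge0_integral_mscale _ _ _ _ _ measurableT (NngNum k0))//; last first.
  by move=> x _; rewrite lee_fin.
by apply: eq_measure_integral => A mA _; rewrite angular_measure_scale.
Qed.

Lemma tail_integral_fin_num (g : E -> R) M s :
  measurable_fun setT (g : borel E -> R) -> (forall x, 0 <= g x <= M) ->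
  0 < s -> tail_integral mu g s \is a fin_num.
Proof.
move=> mg gM s0; rewrite ge0_fin_numE; last first.
  by apply: tail_integral_ge0 => x; case/andP: (gM x).
apply: le_lt_trans (@tail_integral_bounded _ _ _ _ mg _ M _ _) _.
- by move=> x; case/andP: (gM x).
- by move=> x; case/andP: (gM x).
- apply: lte_mul_pinfty => //; last exact: outside_lty.
  by rewrite lee_fin; case/andP: (gM 0) => /le_trans; apply.
Qed.

(** If {|x| > 1} were null, so would be every {|x| > 1/(n+1)} by homogeneity, and these sets exhaust
    the complement of 0. *)
Lemma outside1_gt0 : mu (@punctured R E) != 0%E -> (0 < mu (outside E 1))%E.
Proof.
move=> mu0; rewrite lt0e measure_ge0 andbT; apply: contra_neq mu0 => mu1.
have outN n : mu.-negligible (outside E n.+1%:R^-1).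
  apply/negligibleP; first exact: measurable_outside.
  have n0 : 0 < n.+1%:R^-1 :> R by rewrite invr_gt0 ltr0n.
  have := angular_measure_scale n0 measurableT.
  by rewrite !angular_measureE !preimage_setT !setTI mu1 mule0.
apply/negligibleP; first exact: measurable_punctured.
apply: negligibleS (negligible_bigcup outN).
move=> x /eqP; rewrite -normr_gt0 => /ltr_add_invr[k].
by rewrite add0r => kx; exists k.
Qed.

End homogeneous_measure.

(** * Asymptotics of tail integrals along the reals *)

Section tail_limit.
Context {R : realType} (E : normedModType R) (alpha : R).
Context d (Omega : measurableType d) (P : probability Omega R).
Variables (X : {RV P >-> borel E}) (mu : {measure set (borel E) -> \bar R}).
Variable b : R -> {nonneg R}.
Hypothesis alpha0 : 0 < alpha.
Hypothesis M0mu : M0 mu.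
Hypothesis mu_scale : forall (t : R) (A : set (borel E)), 0 < t ->
  measurable A -> A `<=` @punctured R E ->
  mu [set t *: (x : E) | x in A] = ((t `^ (- alpha))%:E * mu A)%E.
Hypothesis X_mu : M0_cvg
  (fun n => mscale (b n%:R) (distribution P (dilate n%:R^-1 \o X))) mu.

Let mu_ n := mscale (b n%:R) (distribution P (dilate n%:R^-1 \o X)).

(** Dilation preserves directions, so only the threshold moves, from s to n * s: convergence of
    [mu_ n] becomes a statement about the tails of X itself. *)
Lemma tail_integral_dilate (g : E -> R) n s : (0 < n)%N ->
  measurable_fun setT (g : borel E -> R) -> (forall x, 0 <= g x) ->
  tail_integral (mu_ n) g s =
  ((b n%:R)%:num%:E * tail_integral (distribution P X) g (n%:R * s))%E.
Proof.
move=> n0 mg g0; have mgn := measurable_normalize_comp mg.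
have nR0 : 0 < n%:R :> R by rewrite ltr0n.
rewrite /tail_integral ge0_integral_mscale; last 3 first.
- exact: measurable_outside.
- exact: measurable_funTS.
- by move=> x _; rewrite lee_fin.
congr (_ * _)%E.
rewrite (ge0_integral_pushforward (@measurable_funPT _ _ _ _ (dilate n%:R^-1 \o X)));
  last 3 first.
- exact: measurable_outside.
- exact: measurable_funTS.
- by move=> x _; rewrite lee_fin.
rewrite (ge0_integral_pushforward (@measurable_funPT _ _ _ _ X)); last 3 first.
- exact: measurable_outside.
- exact: measurable_funTS.
- by move=> x _; rewrite lee_fin.
have -> : (dilate n%:R^-1 \o X) @^-1` outside E s = X @^-1` outside E (n%:R * s).
  apply/seteqP; split=> w; rewrite /outside/= /dilate normrZ gtr0_norm ?invr_gt0//;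
  by rewrite ltr_pdivlMl.
by apply: eq_integral => w _ /=; rewrite normalizeZ// invr_gt0.
Qed.

Section fixed_integrand.
Variables (g : E -> R) (M : R).
Hypothesis cg : continuous g.
Hypothesis g_bnd : forall x, 0 <= g x <= M.

Let g0 x : 0 <= g x. Proof. by case/andP: (g_bnd x). Qed.
Let gM x : g x <= M. Proof. by case/andP: (g_bnd x). Qed.
Let mg := continuous_measurable_borel cg.

Let a t := fine (tail_integral (distribution P X) g t).
Let j := fine (tail_integral mu g 1).

Lemma tail_integral_distribution_fin_num t :
  tail_integral (distribution P X) g t \is a fin_num.
Proof.
rewrite ge0_fin_numE; last exact: tail_integral_ge0.
apply: le_lt_trans (@tail_integral_bounded _ _ _ _ mg _ M _ gM) _ => //.
apply: lte_mul_pinfty => //; first by rewrite lee_fin (le_trans (g0 0)).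
apply: le_lt_trans (probability_le1 (distribution P X) _) _; last exact: ltry.
exact: measurable_outside.
Qed.

Let tail_dist t : tail_integral (distribution P X) g t = (a t)%:E.
Proof. by rewrite fineK// tail_integral_distribution_fin_num. Qed.

Let tail_mu s : 0 < s -> tail_integral mu g s = (s `^ (- alpha) * j)%:E.
Proof.
move=> s0; rewrite (tail_integral_scale mu_scale)// EFinM fineK//.
exact: (tail_integral_fin_num M0mu mg g_bnd).
Qed.

Let tail_le s t : s <= t -> a t <= a s.
Proof. by move=> st; rewrite -lee_fin -!tail_dist tail_integral_le. Qed.

Let sandwich s t : 0 < s < t -> exists r : nat -> R, exists l : R,
  [/\ r n @[n --> \oo] --> l, t `^ (- alpha) * j <= l <= s `^ (- alpha) * j &
      forall n, (0 < n)%N ->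
        (b n%:R)%:num * a (n%:R * t) <= r n <= (b n%:R)%:num * a (n%:R * s)].
Proof.
move=> /[dup] st /andP[s0 lt_st]; have t0 := lt_trans s0 lt_st.
pose f (x : E) := g (normalize x) * ramp s t x.
have := X_mu (ramp_C0_fun cg g_bnd st); rewrite -/f => rl.
have bnd (m : {measure set (borel E) -> \bar R}) :=
  ramp_integral_bounds m mg g0 st.
have muf : (\int[mu]_(x in @punctured R E) (f x)%:E)%E \is a fin_num.
  have /andP[l1 l2] := bnd mu.
  rewrite ge0_fin_numE; first by rewrite (le_lt_trans l2)// tail_mu// ltry.
  by apply: le_trans l1; exact: tail_integral_ge0.
exists (fun n => fine (\int[mu_ n]_(x in @punctured R E) (f x)%:E)%E).
exists (fine (\int[mu]_(x in @punctured R E) (f x)%:E)%E); split.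
- by move: rl; rewrite -(fineK muf) => /fine_cvgP[].
- by have := bnd mu; rewrite !tail_mu// -!lee_fin fineK.
- move=> n n0; have := bnd (mu_ n); rewrite !tail_integral_dilate// !tail_dist.
  rewrite -!EFinM => /andP[l1 l2].
  have l0 := le_trans (tail_integral_ge0 (mu_ n) g0 t) (andP (bnd (mu_ n))).1.
  have fin : (\int[mu_ n]_(x in @punctured R E) (f x)%:E)%E \is a fin_num.
    by rewrite ge0_fin_numE// (le_lt_trans l2)// ltry.
  by rewrite -!lee_fin fineK// l1.
Qed.

(* Monotonicity of the tail integral replaces the uniform convergence theorem
   for b: for t in [n, n + 1] the tail at t is squeezed between those at n and
   at n * delta for any fixed delta > 1. *)
Lemma cvg_tail_integral :
  (b (Num.trunc t)%:R)%:num * fine (tail_integral (distribution P X) g t)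
    @[t --> +oo] --> fine (tail_integral mu g 1).
Proof.
rewrite -/j; have j0 : 0 <= j by rewrite fine_ge0// tail_integral_ge0.
(* With 2 * eta * j < e, which also covers j = 0, both (1 + eta) * j and (1 + eta)^(-2) * j >= (1 -
   2 * eta) * j lie within e of j. *)
apply/cvgrPdist_lt => e e0; pose eta := e / (j + 1) / 2.
have eta0 : 0 < eta by rewrite !divr_gt0// ltr_wpDl.
have etaj : 2 * (eta * j) < e.
  rewrite (_ : 2 * _ = e * j / (j + 1)); last by rewrite /eta; field; lra.
  by rewrite ltr_pdivrMr ?ltr_wpDl// ltr_pM2l// ltrDl.
(* Multiplying a level by [del] divides the tail integral of mu by 1 + eta. *)
pose del := (1 + eta) `^ alpha^-1.
have delE : del `^ alpha = 1 + eta.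
  by rewrite -powRrM mulVf ?gt_eqF// powRr1//; lra.
have del1 : 1 < del.
  have <- : 1 `^ alpha^-1 = 1 :> R by rewrite powR1.
  by apply: gt0_ltr_powR; rewrite ?nnegrE ?invr_gt0//; lra.
have del0 : 0 < del by lra.
have delV : 0 < del^-1 < 1 by rewrite invr_gt0 del0 invf_lt1.
have deldel : 0 < del < del * del by rewrite del0 ltr_pMr.
(* The ramp from 1/del to 1 bounds the tail at n from above, with limit at most (1 + eta) * j. The
   ramp from del to del^2 bounds the tail at n * del from below, with limit at least (1 + eta)^(-2)
   * j. *)
have [ru [lu [ru_lu /andP[_ lu_le] ru_ge]]] := sandwich delV.
have [rl [ll [rl_ll /andP[ll_ge _] rl_le]]] := sandwich deldel.
have {}lu_le : lu < j + e.
  apply: le_lt_trans lu_le _.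
  rewrite -powR_inv1 ?(ltW del0)// -powRrM mulN1r opprK delE.
  by have := mulr_ge0 (ltW eta0) j0; lra.
have {}ll_ge : j - e < ll.
  apply: lt_le_trans ll_ge; rewrite powRN powRM ?(ltW del0)// delE.
  have e1 : 0 < (1 + eta) * (1 + eta) by nra.
  suff : (1 - 2 * eta) <= ((1 + eta) * (1 + eta))^-1.
    by move=> /(ler_wpM2r j0); lra.
  by rewrite -div1r ler_pdivlMr//; nra.
have trunc_oo (Q : nat -> Prop) : (\forall n \near \oo, Q n) ->
    \forall t \near +oo, Q (Num.trunc (t : R)).
  move=> [N _ NQ]; near=> t; apply: NQ; rewrite /= truncn_ge_nat.
    by near: t; exact: nbhs_pinfty_ge.
  by near: t; exact: nbhs_pinfty_ge.
have ru_near := trunc_oo _ (cvgr_lt _ ru_lu _ lu_le).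
have rl_near := trunc_oo _ (cvgr_gt _ rl_ll _ ll_ge).
have n0_near := trunc_oo _ (nbhs_infty_gt 0).
(* n >= 1 / (del - 1) amounts to n + 1 <= n * del, so t < n + 1 puts t below n * del. *)
have del_near := trunc_oo _ (nbhs_infty_ger (del - 1)^-1).
near=> t.
have t0 : 0 <= t by near: t; exact: nbhs_pinfty_ge.
have /andP[nt tn] := truncn_itv t0.
have n0 : (0 < Num.trunc t)%N by near: t; exact: n0_near.
have ndel : (del - 1)^-1 <= (Num.trunc t)%:R by near: t; exact: del_near.
have {ndel tn}tn : t <= (Num.trunc t)%:R * del.
  apply: ltW; apply: lt_le_trans tn _; rewrite -natr1.
  by move: ndel; rewrite -div1r ler_pdivrMr; lra.
have /andP[up _] := ru_ge _ n0; have /andP[_ lo] := rl_le _ n0.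
have b0 : 0 <= (b (Num.trunc t)%:R)%:num by [].
have {}up : (b (Num.trunc t)%:R)%:num * a t < j + e.
  apply: (@le_lt_trans _ _ (ru (Num.trunc t))); last by near: t; exact: ru_near.
  by apply: le_trans up; apply: ler_wpM2l => //; apply: tail_le; rewrite mulr1.
have {}lo : j - e < (b (Num.trunc t)%:R)%:num * a t.
  apply: (@lt_le_trans _ _ (rl (Num.trunc t))); first by near: t; exact: rl_near.
  by apply: le_trans lo _; apply: ler_wpM2l => //; exact: tail_le.
by rewrite ltr_distlC lo up.
Unshelve. all: by end_near. Qed.

End fixed_integrand.
End tail_limit.

(** The bounds on the total mass exclude the case where [mnormalize] returns its default [P]. *)
Lemma ge0_integral_mnormalize d (T : measurableType d) (R : realType)
    (m : {measure set T -> \bar R}) (P : probability T R) (f : T -> \bar R) :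
  (0 < m setT < +oo)%E -> measurable_fun setT f -> (forall x, 0 <= f x)%E ->
  (\int[mnormalize m P]_x f x = (fine (m setT))^-1%:E * \int[m]_x f x)%E.
Proof.
move=> /andP[m0 moo] mf f0.
have k0 : 0 <= (fine (m setT))^-1 by rewrite invr_ge0 fine_ge0.
rewrite -(@ge0_integral_mscale _ _ _ _ _ measurableT (NngNum k0))//.
apply: eq_measure_integral => A mA _.
by rewrite /= /mnormalize gt_eqF// lt_eqF//= /mscale/= muleC.
Qed.

(** * Weak limits of probabilities *)

Section weak_convergence.
Context {R : realType} (E : normedModType R).

Lemma integral_addr_cst (P : probability (borel E) R) (g : E -> R) (M c : R) :
  measurable_fun setT (g : borel E -> R) -> (forall x, `|g x| <= M) ->
  (\int[P]_x (g x + c)%:E = \int[P]_x (g x)%:E + c%:E)%E.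
Proof.
move=> mg gM; have PT : (P setT < +oo)%E by rewrite (le_lt_trans (probability_le1 P _)) ?ltry.
have ig : P.-integrable setT (EFin \o (g : borel E -> R)).
  apply: measurable_bounded_integrable => //.
  exists M; split; first exact: num_real.
  by move=> N MN x _; exact: le_trans (gM x) (ltW MN).
have ic : P.-integrable setT (EFin \o cst c : borel E -> \bar R).
  exact: finite_measure_integrable_cst.
under eq_integral do rewrite EFinD.
rewrite (integralD measurableT ig ic); congr (_ + _)%E.
apply: (etrans (integral_cst P measurableT c%:E)).
by rewrite -[RHS]mule1; congr (_ * _)%E; exact: (probability_setT P).
Qed.

(** Adding a constant makes a bounded test function nonnegative, and shifts its integral against any
    probability by that same constant. *)
Lemma weak_cvg_nonneg (I : Type) (F : set_system I) {FF : Filter F}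
    (nu_ : I -> probability (borel E) R) (nu : probability (borel E) R) :
  (forall (g : E -> R) M, continuous g -> (forall x, 0 <= g x <= M) ->
    (\int[nu_ i]_x (g x)%:E)%E @[i --> F] --> (\int[nu]_x (g x)%:E)%E) ->
  weak_cvg F nu_ nu.
Proof.
move=> cvg_nu g cg [N [_ gN]]; pose M := `|N| + 1.
have gM x : `|g x| <= M.
  by apply: gN => //; rewrite /M (le_lt_trans (ler_norm _))// ltrDl.
pose h x := g x + M.
have ch : continuous h by move=> x; apply: cvgD; [exact: cg|exact: cvg_cst].
have h_bnd x : 0 <= h x <= M + M.
  by have := gM x; rewrite ler_norml /h => /andP[? ?]; apply/andP; split; lra.
have mh := continuous_measurable_borel ch.
have gE (P : probability (borel E) R) :
    (\int[P]_x (g x)%:E = \int[P]_x (h x)%:E - M%:E)%E.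
  rewrite -EFinN -(@integral_addr_cst P h (M + M))//.
    by apply: eq_integral => x _; rewrite /h addrK.
  by move=> x; have /andP[h0 hM] := h_bnd x; rewrite ger0_norm.
rewrite gE; under eq_fun do rewrite gE.
by apply: cvgeB; [exact: fin_num_adde_defl|exact: cvg_nu ch h_bnd|exact: cvg_cst].
Qed.

Lemma weak_cvg_unique (I : Type) (F : set_system I) {FF : ProperFilter F}
    (nu_ : I -> probability (borel E) R) (nu nu' : probability (borel E) R) :
  weak_cvg F nu_ nu -> weak_cvg F nu_ nu' ->
  forall A, measurable A -> nu A = nu' A.
Proof.
move=> nu_nu nu_nu'; apply: probability_borel_unique => g cg g01.
have bg : bounded_fun g.
  exists 1; split; first exact: num_real.
  move=> N N1 x _ /=; have /andP[g0 g1] := g01 x.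
  by rewrite ger0_norm// (le_trans g1)// ltW.
exact: (cvg_unique _ (nu_nu g cg bg) (nu_nu' g cg bg)).
Qed.

End weak_convergence.

(** * The angular limit of a regularly varying element *)

Section angular_limit.
Context {R : realType} (E : normedModType R) (alpha : R).
Context d (Omega : measurableType d) (P : probability Omega R).
Variable X : {RV P >-> borel E}.

Lemma integral_angular_law (g : E -> R) t :
  measurable_fun setT (g : borel E -> R) -> (forall x, 0 <= g x) ->
  (0 < P (exceedance X t))%E ->
  (\int[angular_law X t]_x (g x)%:E = (fine (P (exceedance X t)))^-1%:E *
    tail_integral (distribution P X) g t)%E.
Proof.
move=> mg g0 P0.
have mEg : measurable_fun setT (fun x : borel E => (g x)%:E).
  exact/measurable_EFinP.
rewrite (ge0_integral_pushforward
  (@measurable_funPT _ _ _ _ (normalize \o X)))//; last first.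
  by move=> x _; rewrite lee_fin.
rewrite preimage_setT ge0_integral_mnormalize; last 3 first.
- rewrite /= /mrestr setTI P0/=.
  by rewrite (le_lt_trans (probability_le1 P (measurable_exceedance X t))) ?ltry.
- exact: (measurableT_comp mEg (@measurable_funPT _ _ _ _ (normalize \o X))).
- by move=> x /=; rewrite lee_fin.
congr (_ * _)%E; first by rewrite /= /mrestr setTI.
rewrite (ge0_integral_mrestr P (measurable_exceedance X t)); last 2 first.
- exact: (measurableT_comp mEg (@measurable_funPT _ _ _ _ (normalize \o X))).
- by move=> x /=; rewrite lee_fin.
rewrite /tail_integral (ge0_integral_pushforward (@measurable_funPT _ _ _ _ X)); last 3 first.
- exact: measurable_outside.
- exact: (measurable_funTS (measurable_normalize_comp mg)).
- by move=> x _; rewrite lee_fin.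
by [].
Qed.

Variables (mu : {measure set (borel E) -> \bar R}) (b : R -> {nonneg R}).
Hypothesis alpha0 : 0 < alpha.
Hypothesis M0mu : M0 mu.
Hypothesis mu_neq0 : mu (@punctured R E) != 0%E.
Hypothesis mu_scale : forall (t : R) (A : set (borel E)), 0 < t ->
  measurable A -> A `<=` @punctured R E ->
  mu [set t *: (x : E) | x in A] = ((t `^ (- alpha))%:E * mu A)%E.
Hypothesis X_mu : M0_cvg
  (fun n => mscale (b n%:R) (distribution P (dilate n%:R^-1 \o X))) mu.

Lemma angular_measure1_bounds : (0 < angular_measure mu 1 setT < +oo)%E.
Proof.
rewrite angular_measureE preimage_setT setTI.
by rewrite (outside1_gt0 mu_scale)// outside_lty.
Qed.

(** The conditional expectation of [g] is the ratio of the tail integrals of [g] and of 1.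
    Multiplied by the same value of [b], each converges, and the limit of the denominator is
    positive. *)
Lemma angular_limit_mnormalize (Q : probability (borel E) R) :
  angular_limit P X (mnormalize (angular_measure mu 1) Q).
Proof.
apply: weak_cvg_nonneg => g M cg g_bnd.
have mg := continuous_measurable_borel cg.
have g0 x : 0 <= g x by case/andP: (g_bnd x).
pose K := fine (tail_integral mu (cst 1) 1).
have tail1 (m : {measure set (borel E) -> \bar R}) s :
    tail_integral m (cst 1) s = m (outside E s).
  rewrite /tail_integral/= integral_cst ?mul1e//; exact: measurable_outside.
have K0 : 0 < K.
  rewrite /K tail1 fine_gt0// (outside1_gt0 mu_scale)//= outside_lty//.
have c1 : continuous (cst 1 : E -> R) by move=> x; exact: cvg_cst.
have bnd1 (x : E) : 0 <= (cst 1 x : R) <= 1 by rewrite /= ler01 lexx.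
have lim1 := cvg_tail_integral alpha0 M0mu mu_scale X_mu c1 bnd1.
have limg := cvg_tail_integral alpha0 M0mu mu_scale X_mu cg g_bnd.
have near1 := cvgr_gt _ lim1 _ K0.
have fin_g t := tail_integral_distribution_fin_num X cg g_bnd t.
rewrite ge0_integral_mnormalize; last 3 first.
- exact: angular_measure1_bounds.
- exact/measurable_EFinP.
- by move=> x; rewrite lee_fin.
rewrite -tail_integral_angular// angular_measureE preimage_setT setTI -tail1 -/K.
rewrite -(fineK (tail_integral_fin_num M0mu mg g_bnd ltr01)) -EFinM.
have K_neq0 : K != 0 by rewrite gt_eqF.
have lim_ratio := cvgM (cvgV K_neq0 lim1) limg.
have lim_E : (((b (Num.trunc t)%:R)%:num *
      fine (tail_integral (distribution P X) (cst 1) t))^-1 *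
    ((b (Num.trunc t)%:R)%:num *
      fine (tail_integral (distribution P X) g t)))%:E @[t --> +oo] -->
    (K^-1 * fine (tail_integral mu g 1))%:E.
  by apply: cvg_EFin; [exact: nearW|exact: lim_ratio].
apply: cvg_trans lim_E; apply: near_eq_cvg; near=> t.
(* The product tends to K > 0, so eventually neither factor is zero: [b] can be cancelled, and
   [angular_law] is a true conditional law rather than its default. *)
have bP : 0 < (b (Num.trunc t)%:R)%:num *
    fine (tail_integral (distribution P X) (cst 1) t).
  by near: t; exact: near1.
have PE : tail_integral (distribution P X) (cst 1) t = P (exceedance X t).
  exact: tail1.
rewrite PE in bP *.
have b_neq0 : (b (Num.trunc t)%:R)%:num != 0.
  by apply: contraTneq bP => ->; rewrite mul0r ltxx.
have P_neq0 : fine (P (exceedance X t)) != 0.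
  by apply: contraTneq bP => ->; rewrite mulr0 ltxx.
rewrite integral_angular_law//; last first.
  by rewrite lt0e measure_ge0 andbT; apply: contra_neq P_neq0 => ->.
rewrite -(fineK (fin_g t)) -EFinM /=; congr EFin.
by rewrite invfM mulrACA mulVf// mul1r.
Unshelve. all: by end_near. Qed.

Lemma angular_limitE (nu : probability (borel E) R) :
  angular_limit P X nu -> forall A, measurable A ->
  nu A = (angular_measure mu 1 A * (fine (angular_measure mu 1 setT))^-1%:E)%E.
Proof.
move=> X_nu A mA.
(* [mnormalize] asks for a default probability; [nu] itself is at hand. *)
rewrite (weak_cvg_unique X_nu (@angular_limit_mnormalize nu))//.
have /andP[s0 soo] := angular_measure1_bounds.
by rewrite /= /mnormalize gt_eqF// lt_eqF.
Qed.

End angular_limit.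

(** * Integration in polar coordinates *)

Section polar.
Context {R : realType} (E : normedModType R) (alpha : R).
Variable mu : {measure set (borel E) -> \bar R}.
Hypothesis alpha0 : 0 < alpha.
Hypothesis mu_scale : forall (t : R) (A : set (borel E)), 0 < t ->
  measurable A -> A `<=` @punctured R E ->
  mu [set t *: (x : E) | x in A] = ((t `^ (- alpha))%:E * mu A)%E.

(** In the coordinate u = r^(- alpha) this is the region 0 < u < v(theta) under the graph of v, and
    the radial part of a homogeneous measure becomes Lebesgue measure in u. *)
Definition polar_epigraph (v : E -> R) : set (borel E) :=
  [set x | 1 < `|x : E| `^ alpha * v (normalize x)].

Lemma measurable_polar_epigraph (v : E -> R) :
  measurable_fun setT (v : borel E -> R) -> measurable (polar_epigraph v).
Proof.
move=> mv.
have mf : measurable_fun setT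
    (fun x : borel E => `|x : E| `^ alpha * v (normalize x)).
  apply: measurable_funM.
    exact: (measurableT_comp (measurable_powR alpha) (@norm_borel R E)).
  exact: (measurableT_comp mv (@measurable_funPT _ _ _ _ (@normalize R E))).
have := mf measurableT _ (measurable_itv `]1, +oo[).
by rewrite setTI; congr measurable; apply/seteqP; split=> x /=; rewrite in_itv/= andbT.
Qed.

Lemma gt0_ltr_powR_mono (r x y : R) : 0 < r -> 0 <= x -> 0 <= y ->
  (x `^ r < y `^ r) = (x < y).
Proof.
move=> r0 x0 y0; apply/idP/idP; last by apply: gt0_ltr_powR.
by apply: contra_ltT; rewrite -!leNgt; apply: ge0_ler_powR => //; exact: ltW.
Qed.

Import HBNNSimple.

(** Split the epigraph according to the value y of v in the direction of x. For y > 0 the piece is a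
    cone truncated at s = y^(- 1 / alpha), of mass s^(- alpha) = y times the angular measure of {v =
    y}; for y = 0 it is empty. *)
Lemma polar_nnsfun (v : {nnsfun borel E >-> R}) :
  (mu (polar_epigraph v) = \int[angular_measure mu 1]_x (v x)%:E)%E.
Proof.
rewrite integralT_nnsfun sintegralE.
pose F (y : R) := polar_epigraph v `&` (v \o normalize) @^-1` [set y].
have mF y : measurable (F y).
  apply: measurableI; first exact: measurable_polar_epigraph.
  rewrite comp_preimage; apply: measurable_funPTI; exact: measurable_funPTI.
have -> : polar_epigraph v = \bigcup_(y in range v) F y.
  apply/seteqP; split=> [x vx|x [y _ []]//].
  by exists (v (normalize x)) => //; exists (normalize x).
have tF : trivIset (range v) F by move=> y z _ _ [x [[_ /= <-] [_ /= <-]]].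
rewrite (measure_fin_bigcup mu _ tF (fun y _ => mF y))//.
apply: eq_fsbigr => y /set_mem[x0 _ <-{y}]; set y := v x0.
have : 0 <= y by exact: fun_ge0.
rewrite le_eqVlt => /predU1P[<-|y0].
  rewrite mul0e (_ : F 0 = set0) ?measure0//; apply/seteqP; split=> // x [].
  by rewrite /polar_epigraph/= => + vx; rewrite vx mulr0 ltr10.
pose s := y^-1 `^ alpha^-1.
have s0 : 0 < s by rewrite powR_gt0// invr_gt0.
have sE : s `^ alpha = y^-1.
  by rewrite -powRrM mulVf ?gt_eqF// powRr1// invr_ge0 ltW.
rewrite -[X in (X%:E * _)%E]invrK -sE -powRN -(angular_measure_scale mu_scale)//.
rewrite angular_measureE; congr (mu _); apply/seteqP.
have outE (x : borel E) : (1 < `|x : E| `^ alpha * y) = (s < `|x : E|).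
  by rewrite -ltr_pdivrMr// div1r -sE gt0_ltr_powR_mono// ltW.
split=> x [] /=; rewrite /polar_epigraph /outside/=.
  by move=> xy vx; split=> //; rewrite -outE -[X in _ * X]vx.
by move=> vx; rewrite -outE -[X in _ * X]vx => sx; split.
Qed.

(* In polar coordinates mu is the product of the angular measure with the
   measure on ]0, +oo[ giving mass r ^ (- alpha) to ]r, +oo[, and the epigraph
   of v is the set r > v(theta) ^ (- 1 / alpha). *)
Lemma polar_integral (v : E -> R) : measurable_fun setT (v : borel E -> R) ->
  (forall x, 0 <= v x) ->
  (mu (polar_epigraph v) = \int[angular_measure mu 1]_x (v x)%:E)%E.
Proof.
move=> mv v0.
have mEv : measurable_fun setT (EFin \o (v : borel E -> R)).
  exact/measurable_EFinP.
pose v_ := nnsfun_approx measurableT mEv.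
have v_v x : (v_ n x)%:E @[n --> \oo] --> (v x)%:E.
  by apply: (@cvg_nnsfun_approx _ _ _ _ measurableT _ mEv) => // y _; rewrite lee_fin.
have v_nd m n x : (m <= n)%N -> v_ m x <= v_ n x.
  by move=> mn; apply/lefP/nd_nnsfun_approx.
have v_r x : v_ n x @[n --> \oo] --> v x by have /fine_cvgP[_] := v_v x.
have v_le n x : v_ n x <= v x.
  have <- : limn (fun n => v_ n x) = v x by apply/cvg_lim => //; exact: v_r.
  apply: (nondecreasing_cvgn_le (u_ := fun n => v_ n x)).
    by move=> m k; exact: v_nd.
  by apply/cvg_ex; exists (v x); exact: v_r.
have lim_mu : mu (polar_epigraph (v_ n)) @[n --> \oo] --> mu (polar_epigraph v).
  (* The inequality defining the epigraph is strict, so if it holds for the limit [v] it already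
     holds for some [v_ n]. *)
  have -> : polar_epigraph v = \bigcup_n polar_epigraph (v_ n).
    apply/seteqP; split=> [x|x [n _]]; rewrite /polar_epigraph/=.
      move=> xv; have x0 : 0 < `|x : E| `^ alpha.
        rewrite lt_neqAle powR_ge0 andbT; apply: contraTneq xv => <-.
        by rewrite mul0r ltr10.
      have xv' : (`|x : E| `^ alpha)^-1 < v (normalize x).
        by rewrite -div1r ltr_pdivrMr// mulrC.
      have [N _ NP] := cvgr_gt _ (v_r (normalize x)) _ xv'.
      exists N => //=; rewrite mulrC -ltr_pdivrMr// div1r.
      exact: (NP N (leqnn N)).
    by move=> /lt_le_trans; apply; rewrite ler_wpM2l// powR_ge0.
  apply: nondecreasing_cvg_mu.
  - by move=> n; exact: measurable_polar_epigraph.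
  - by apply: bigcup_measurable => n _; exact: measurable_polar_epigraph.
  - move=> m n mn; apply/subsetPset => x; rewrite /polar_epigraph/=.
    by move=> /lt_le_trans; apply; rewrite ler_wpM2l ?powR_ge0// v_nd.
have lim_int : (\int[angular_measure mu 1]_x (v_ n x)%:E)%E @[n --> \oo] -->
    (\int[angular_measure mu 1]_x (v x)%:E)%E.
  have -> : (\int[angular_measure mu 1]_x (v x)%:E =
      \int[angular_measure mu 1]_x limn (fun n => (v_ n x)%:E))%E.
    by apply: eq_integral => x _; apply/esym/cvg_lim => //; exact: v_v.
  apply: cvg_monotone_convergence => //.
  - by move=> n; exact/measurable_EFinP.
  - by move=> n x _; rewrite lee_fin.
  - by move=> x _ m n mn; rewrite lee_fin v_nd.
have eq_lim : (fun n => mu (polar_epigraph (v_ n))) =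
    (fun n => \int[angular_measure mu 1]_x (v_ n x)%:E)%E.
  by apply/funext => n; exact: polar_nnsfun.
rewrite eq_lim in lim_mu; exact: (cvg_unique _ lim_mu lim_int).
Qed.

End polar.

(** * Transport along an injective homogeneous contraction *)

Section regular_variation_image.
Context {R : realType} (E F : normedModType R) (T : {mfun borel E >-> borel F}).
Hypothesis T_cont : continuous (T : E -> F).
Hypothesis TZ : forall r (x : E), T (r *: x) = r *: (T x : F) :> F.
Hypothesis T_eq0 : forall x : E, T x = 0 :> F -> x = 0.
Hypothesis T_le : forall x : E, `|T x : F| <= `|x|.

Let T0 : T (0 : E) = 0 :> F.
Proof. by rewrite -(scale0r (0 : E)) TZ scale0r. Qed.

Lemma preimage_punctured : T @^-1` (@punctured R F) = @punctured R E.
Proof.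
apply/seteqP; split=> x; rewrite /punctured/= => x0 y; apply: x0.
  by rewrite y T0.
exact: T_eq0.
Qed.

(** Transferring the positive and negative parts separately gives the formula for signed [f] without
    any integrability assumption. *)
Lemma integral_image_punctured (m : {measure set (borel E) -> \bar R})
    (f : F -> R) : measurable_fun setT (f : borel F -> R) ->
  (\int[image_measure m T]_(x in @punctured R F) (f x)%:E =
   \int[m]_(x in @punctured R E) (f (T x))%:E)%E.
Proof.
move=> mf; have mEf : measurable_fun (@punctured R F) (EFin \o (f : borel F -> R)).
  exact/measurable_funTS/measurable_EFinP.
have mT := @measurable_funPT _ _ _ _ T.
have mF := @measurable_punctured R F.
rewrite integralE [RHS]integralE -preimage_punctured.
rewrite (ge0_integral_pushforward mT m mF (measurable_funepos mEf))//.
rewrite (ge0_integral_pushforward mT m mF (measurable_funeneg mEf))//.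
by congr (_ - _)%E; apply: eq_integral => x _; rewrite /= ?funeposE ?funenegE.
Qed.

Variables (alpha : R) (mu : {measure set (borel E) -> \bar R}).

(** Injectivity prevents mass from collapsing to 0. From e <= |T x| <= |x|, the preimage of a set
    bounded away from 0 is bounded away from 0. *)
Lemma M0_image : M0 mu -> M0 (image_measure mu T).
Proof.
move=> [mu0 mu_fin]; split.
  rewrite -mu0; congr (mu _).
  by apply/seteqP; split=> x /= => [/T_eq0|->].
move=> A e mA e0 Ae; apply: (mu_fin _ e) => //.
  exact: measurable_funPTI.
by move=> x /Ae /le_trans; apply.
Qed.

Lemma scale_image :
  (forall (t : R) (A : set (borel E)), 0 < t -> measurable A ->
    A `<=` @punctured R E ->
    mu [set t *: (x : E) | x in A] = ((t `^ (- alpha))%:E * mu A)%E) ->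
  forall (t : R) (A : set (borel F)), 0 < t -> measurable A ->
    A `<=` @punctured R F ->
    image_measure mu T [set t *: (x : F) | x in A] =
    ((t `^ (- alpha))%:E * image_measure mu T A)%E.
Proof.
move=> mu_scale t A t0 mA A0; rewrite /image_measure /pushforward -mu_scale//.
- congr (mu _); apply/seteqP; split=> [x [y Ay yx]|_ [x Ax <-]] /=.
    exists (t^-1 *: (x : E)); last by rewrite scalerA divff ?scale1r// gt_eqF.
    by rewrite /= TZ -yx scalerA mulVf ?scale1r// gt_eqF.
  by exists (T x) => //; rewrite TZ.
- exact: measurable_funPTI.
- by rewrite -preimage_punctured => x; exact: A0.
Qed.

Lemma normalize_image (x : E) : x != 0 ->
  normalize (T (normalize (x : borel E))) = normalize (T x).
Proof.
by move=> x0; rewrite [normalize (x : borel E)]/normalize TZ normalizeZ ?invr_gt0 ?normr_gt0.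
Qed.

Lemma measurable_norm_powR_image (B : set (borel F)) : measurable B ->
  measurable_fun setT
    (fun x : borel E => `|T x : F| `^ alpha * \1_B (normalize (T x))).
Proof.
move=> mB; apply: measurable_funM.
  apply: (measurableT_comp (measurable_powR alpha)).
  exact: (measurableT_comp (@norm_borel R F) (@measurable_funPT _ _ _ _ T)).
have mnT := measurableT_comp (@measurable_funPT _ _ _ _ (@normalize R F))
  (@measurable_funPT _ _ _ _ T).
have mB1 : measurable_fun setT (\1_B : borel F -> R) by exact: measurable_indic.
exact: (measurableT_comp mB1 mnT).
Qed.

(** With theta = x / |x| one has |T x| = |x| |T theta|, while T x and T theta have the same
    direction. Hence the set measured on the left is the epigraph of the integrand on the right. *)
Lemma angular_measure_image (B : set (borel F)) : 0 < alpha ->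
  (forall (t : R) (A : set (borel E)), 0 < t -> measurable A ->
    A `<=` @punctured R E ->
    mu [set t *: (x : E) | x in A] = ((t `^ (- alpha))%:E * mu A)%E) ->
  measurable B ->
  angular_measure (image_measure mu T) 1 B =
  (\int[angular_measure mu 1]_x
    (`|T x : F| `^ alpha * \1_B (normalize (T x)))%:E)%E.
Proof.
move=> alpha0 mu_scale mB.
rewrite -(polar_integral alpha0 mu_scale
  (v := fun x : E => `|T x : F| `^ alpha * \1_B (normalize (T x)))); last 2 first.
- exact: measurable_norm_powR_image.
- by move=> x; rewrite mulr_ge0 ?powR_ge0.
rewrite angular_measureE; congr (mu _); apply/seteqP.
have polarE (x : E) : x != 0 ->
    `|x| `^ alpha * (`|T (normalize x) : F| `^ alpha *
      \1_B (normalize (T (normalize x)))) =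
    `|T x : F| `^ alpha * \1_B (normalize (T x)).
  move=> x0; rewrite normalize_image// mulrA -powRM//; congr (_ `^ _ * _).
  have -> : T x = `|x| *: (T (normalize (x : borel E)) : F).
    by rewrite -TZ normrM_normalize.
  by rewrite normrZ normr_id.
have gt1_powR (r : R) : 0 <= r -> (1 < r `^ alpha) = (1 < r).
  by move=> r0; rewrite -(gt0_ltr_powR_mono alpha0 ler01 r0) powR1.
split=> x; rewrite /polar_epigraph /outside/=.
  move=> [Bx x1]; have x0 : x != 0 :> E.
    by apply: contraTneq x1 => ->; rewrite T0 normr0 ltr10.
  by rewrite polarE// indicE mem_set// mulr1 gt1_powR.
have [->|x0] := eqVneq (x : E) 0.
  by rewrite normr0 powR0 ?gt_eqF// mul0r ltr10.
rewrite polarE// indicE; case: (boolP (_ \in B)) => [/set_mem Bx|_].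
  by rewrite mulr1 gt1_powR.
by rewrite mulr0 ltr10.
Qed.

Context d (Omega : measurableType d) (P : probability Omega R).
Variables (X : {RV P >-> borel E}) (b : R -> {nonneg R}).

(** Composition with T preserves test functions, vanishing near 0 included since T is continuous and
    T 0 = 0; homogeneity lets T commute with dilations. *)
Lemma M0_cvg_image :
  M0_cvg (fun n => mscale (b n%:R) (distribution P (dilate n%:R^-1 \o X))) mu ->
  M0_cvg (fun n => mscale (b n%:R) (distribution P (dilate n%:R^-1 \o (T \o X))))
    (image_measure mu T).
Proof.
move=> X_mu f [cf [M [_ fM]] f0].
have mf := continuous_measurable_borel cf.
have fT : C0_fun (f \o (T : E -> F)).
  split.
  - by move=> x; apply: continuous_comp; [exact: T_cont|exact: cf].
  - exists M; split; first exact: num_real.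
    by move=> N MN x _; exact: (fM _ MN (T x)).
  - have f0' : \forall y \near (T (0 : E) : F), f y = 0 by rewrite T0.
    exact: (@T_cont (0 : E) _ f0').
have := X_mu _ fT; rewrite -integral_image_punctured//.
apply: cvg_trans; apply: near_eq_cvg; apply: nearW => n.
rewrite -integral_image_punctured//; apply: eq_measure_integral => A mA _.
rewrite /= /image_measure /pushforward/= /mscale/=; congr (_ * P _)%E.
by apply/seteqP; split=> w /=; rewrite /dilate TZ.
Qed.

End regular_variation_image.

(** * Homogeneity and injectivity of the embedding *)

Section L2_of_C01.
Context {R : realType}.

Lemma L2_of_C01Z (r : R) (f : C01 R) :
  L2_of_C01 (r *: f) = r *: (L2_of_C01 f : L201 R) :> L201 R.
Proof. by rewrite /L2_of_C01 -LclassZ; apply: Lclass_eq; exact: nearW. Qed.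

(** A continuous function that is nonzero at a point of [0, 1] is nonzero on a nondegenerate
    subinterval, which has positive measure, so it cannot vanish almost everywhere. *)
Lemma L2_of_C01_eq0 (f : C01 R) : L2_of_C01 f = 0 :> L201 R -> f = 0.
Proof.
move=> Tf0.
(* The zero class is written as the image of the zero function, so that [f] and 0 both agree almost
   everywhere with one representative. *)
have T00 : L2_of_C01 (0 : C01 R) = 0 :> L201 R.
  by rewrite -(scale0r (0 : C01 R)) L2_of_C01Z scale0r.
have ae_f (g : C01 R) :
    {ae leb01 R, forall t, (L2_of_C01 g : L201 R) t = g t}.
  by apply: filterS (LclassE (Lfun_Sub (lee1n 2) (C01_Lfun g))) => t /(_ Logic.I).
have [N [mN N0 fN]] : {ae leb01 R, forall t, f t = 0}.
  move: (ae_f f) (ae_f (0 : C01 R)); rewrite Tf0 T00.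
  by apply: filterS2 => t <- ->.
apply/val_inj/funext => t0 /=; apply/eqP; apply/negPn/negP => ft0.
have It0 : `[0, 1]%classic t0.
  by apply: contrapT => It0; move: ft0; rewrite C01_out// eqxx.
have := (subspace_continuousP _ _).1 (@C01_continuous _ f) t0 It0.
move=> /cvgr_neq0 /(_ ft0); rewrite near_withinE.
move=> /nbhs_ballP[e /= e0 ball_f].
(* Clipping the ball around [t0] to [0, 1] leaves an interval of positive length even when [t0] is
   an endpoint. *)
pose J := `]Num.max 0 (t0 - e), Num.min 1 (t0 + e)[%classic.
have JI : J `<=` `[0, 1].
  move=> t; rewrite /J /= !in_itv/= gt_max lt_min.
  by move=> /andP[/andP[/ltW-> _] /andP[/ltW-> _]].
have JN : J `<=` N.
  move=> t Jt; apply: fN => /= ft.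
  have tb : ball t0 e t.
    rewrite -ball_normE /= distrC ltr_distl.
    move: Jt; rewrite /J/= in_itv/= gt_max lt_min.
    by move=> /andP[/andP[_ ->] /andP[_ ->]].
  by have /eqP := ball_f t tb (JI t Jt); apply.
have mJ : measurable (J : set (measurableTypeR R)) by exact: measurable_itv.
have : (leb01 R J <= leb01 R N)%E by apply: le_measure; rewrite ?inE.
rewrite N0 leNgt => /negP; apply.
rewrite /leb01 /= /mrestr setIidl// lebesgue_measure_itv/= lte_fin.
move: It0; rewrite /= in_itv/= => /andP[t00 t01].
have lt_maxmin : Num.max 0 (t0 - e) < Num.min 1 (t0 + e).
  by rewrite gt_max !lt_min ltr01/=; apply/and3P; split; lra.
by rewrite lt_maxmin -EFinB lte_fin subr_gt0.
Qed.

End L2_of_C01.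

Theorem proposition3p4 (R : realType) (alpha : R)
    (d : measure_display) (Omega : measurableType d) (P : probability Omega R)
    (X : {RV P >-> borel (C01 R)})
    (d' : measure_display) (Omega' : measurableType d')
    (P' : probability Omega' R) (Theta : {RV P' >-> borel (C01 R)}) :
  0 < alpha ->
  regularly_varying P X alpha ->
  angular_limit P X (distribution P' Theta) ->
  regularly_varying P (L2_of_C01 \o X) alpha /\
  (exists nu, angular_limit P (L2_of_C01 \o X) nu) /\
  forall nu : probability (borel (L201 R)) R,
    angular_limit P (L2_of_C01 \o X) nu ->
    forall B : set (borel (L201 R)), measurable B ->
      B `<=` [set x | `|x : L201 R| = 1] ->
      nu B =
      ('E_P'[fun w => (`|L2_of_C01 (Theta w) : L201 R| `^ alpha *
                       \1_B (normalize (L2_of_C01 (Theta w))))%R]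
       / 'E_P'[fun w => (`|L2_of_C01 (Theta w) : L201 R| `^ alpha)%R])%E.
Proof.
move=> alpha0 [mu [b [M0mu mu_neq0 b_rv X_mu mu_scale]]] X_Theta.
pose T : {mfun borel (C01 R) >-> borel (L201 R)} := @L2_of_C01 R.
have T_cont : continuous (T : C01 R -> L201 R) := @L2_of_C01_continuous R.
have TZ := @L2_of_C01Z R.
have T_eq0 := @L2_of_C01_eq0 R.
have T_le := @L2_of_C01_le R.
pose mu2 := image_measure mu T.
have M0mu2 : M0 mu2 := M0_image TZ T_eq0 T_le M0mu.
have mu2_neq0 : mu2 (@punctured R (L201 R)) != 0%E.
  rewrite (_ : mu2 _ = mu (@punctured R (C01 R)))//; congr (mu _).
  exact: (preimage_punctured TZ T_eq0).
have mu2_scale := scale_image TZ T_eq0 mu_scale.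
have X_mu2 := M0_cvg_image T_cont TZ T_eq0 X_mu.
split; first by exists mu2, b.
split.
  (* The law of T X fills the place of the default probability of [mnormalize]. *)
  exists (mnormalize (angular_measure mu2 1) (distribution P (T \o X))).
  exact: (angular_limit_mnormalize alpha0 M0mu2 mu2_neq0 mu2_scale X_mu2).
move=> nu X_nu B mB _.
rewrite (angular_limitE alpha0 M0mu2 mu2_neq0 mu2_scale X_mu2 X_nu)//.
have /andP[s0 soo] := angular_measure1_bounds M0mu mu_neq0 mu_scale.
have /andP[s20 s2oo] := angular_measure1_bounds M0mu2 mu2_neq0 mu2_scale.
(* The law of Theta is c * sigma, so both expectations carry the factor [c], which cancels in the
   quotient. *)
pose c := (fine (angular_measure mu 1 setT))^-1.
have c0 : 0 < c by rewrite invr_gt0 fine_gt0// s0.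
(* Used with [A = B] for the numerator and [A = setT] for the denominator. *)
have expE (A : set (borel (L201 R))) : measurable A ->
    ('E_P'[fun w => (`|L2_of_C01 (Theta w) : L201 R| `^ alpha *
                     \1_A (normalize (L2_of_C01 (Theta w))))%R] =
     c%:E * angular_measure mu2 1 A)%E.
  move=> mA; pose v (x : borel (C01 R)) :=
    `|T x : L201 R| `^ alpha * \1_A (normalize (T x)).
  have mv : measurable_fun setT v := measurable_norm_powR_image T alpha mA.
  have v0 x : 0 <= v x by rewrite mulr_ge0 ?powR_ge0.
  have mEv : measurable_fun setT (EFin \o v) by exact/measurable_EFinP.
  rewrite (angular_measure_image TZ alpha0 mu_scale mA).
  rewrite -(ge0_integral_mnormalize (distribution P' Theta)); last 3 first.
  - by rewrite s0.
  - exact: mEv.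
  - by move=> x; rewrite lee_fin.
  rewrite unlock.
  transitivity (\int[distribution P' Theta]_x (v x)%:E)%E.
    by rewrite ge0_integral_distribution.
  (* The law of Theta and the normalized sigma are both weak limits of the angular laws of X in
     C[0, 1], hence equal. *)
  apply: eq_measure_integral => A' mA' _.
  exact: (weak_cvg_unique X_Theta
    (@angular_limit_mnormalize _ _ _ _ _ _ _ _ _ alpha0 M0mu mu_neq0 mu_scale X_mu _)).
have -> : ('E_P'[fun w => (`|L2_of_C01 (Theta w) : L201 R| `^ alpha)%R] =
    c%:E * angular_measure mu2 1 setT)%E.
  rewrite -expE//; congr expectation.
  by apply/funext => w; rewrite indicT mulr1.
rewrite expE// -(fineK (_ : angular_measure mu2 1 setT \is a fin_num)); last first.
  by rewrite ge0_fin_numE.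
have k0 : 0 < fine (angular_measure mu2 1 setT) by rewrite fine_gt0// s20.
have B_fin : angular_measure mu2 1 B \is a fin_num.
  by rewrite ge0_fin_numE// (le_lt_trans _ s2oo)// le_measure ?inE.
rewrite -(fineK B_fin) -!EFinM.
rewrite inver gt_eqF ?mulr_gt0// -EFinM /=; congr EFin.
by field; rewrite !gt_eqF.
Qed.
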